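(* Let $X$ and $Y$ be finite $T_0$-spaces, with $Y$ a subspace of $X$. If there is an NE-collapse from $X$ to $Y$, then there is an NE-collapse from the complex $\mathcal{K}(X)$ to the subcomplex $\mathcal{K}(Y)$.
   Context: Finite $T_0$-spaces are identified with finite posets: $x\le y$ if and only if $x\in U_y$, where $U_y$ is the minimal open set containing $y$ (so the open sets are the down-sets); subspaces correspond to subsets with the induced order. For $x$ in a finite $T_0$-space $X$, the link $\hat{C}_x$ is the subspace of points of $X$ comparable with $x$ and distinct from $x$. A finite $T_0$-space $X$ is non-evasive if it is a point or, inductively, if there exists $x\in X$ such that both $\hat{C}_x$ and $X\smallsetminus\{x\}$ are non-evasive. If $x\in X$ is such that $\hat{C}_x$ is non-evasive, there is an elementary NE-collapse from $X$ to $X\smallsetminus\{x\}$. There is an NE-collapse from $X$ to a subspace $Y$ if there is a finite (possibly empty) sequence of elementary NE-collapses from $X$ to $Y$. All simplicial complexes are finite. For a vertex $v$ of a complex $K$, $\mathrm{lk}_K(v)$ is the subcomplex of simplices $\tau\in K$ with $v\notin\tau$ and $\tau\cup\{v\}\in K$, and $K\smallsetminus v$ is the full subcomplex of $K$ spanned by the vertices different from $v$. A complex $K$ is non-evasive if it has only one vertex or, inductively, if there is a vertex $v\in K$ such that both $K\smallsetminus v$ and $\mathrm{lk}_K(v)$ are non-evasive. If $v\in K$ is a vertex such that $\mathrm{lk}_K(v)$ is non-evasive, there is an elementary NE-collapse from $K$ to $K\smallsetminus v$; an NE-collapse from $K$ to a subcomplex $L$ is a finite (possibly empty) sequence of elementary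 NE-collapses from $K$ to $L$. For a finite $T_0$-space $X$, $\mathcal{K}(X)$ is the simplicial complex whose simplices are the nonempty chains of the poset $X$. *)

(* Defs.v *)
From HB Require Import structures.
From Stdlib Require Import Relation_Operators.
From mathcomp Require Import all_boot all_order.

Set Implicit Arguments.
Unset Strict Implicit.
Unset Printing Implicit Defensive.

(* A finite T_0-space is a finite poset (the open sets are the down-sets), and
   a subspace is a subset [A : {set T}] of the points of an ambient poset [T],
   with the induced order. *)
Section FiniteSpaces.

Context {d : Order.disp_t} {T : finPOrderType d}.
Implicit Types (A B : {set T}) (x y : T).

Definition space_link A x : {set T} :=
  [set y in A | (y != x) && (y >=< x)%O].

Inductive space_nonevasive : {set T} -> Prop :=
| SpaceNonevasivePoint x : space_nonevasive [set x]
| SpaceNonevasiveStep A x of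
    x \in A & space_nonevasive (space_link A x) & space_nonevasive (A :\ x) :
    space_nonevasive A.

Definition space_NE_elementary A B : Prop :=
  exists x, [/\ x \in A, space_nonevasive (space_link A x) & B = A :\ x].

Definition space_NE_collapse : {set T} -> {set T} -> Prop :=
  clos_refl_trans_1n _ space_NE_elementary.

End FiniteSpaces.

Section Complexes.

Context {V : finType}.

Definition is_complex (S : {set {set V}}) : bool :=
  (set0 \notin S) &&
  [forall s in S, forall t : {set V}, (t != set0) && (t \subset s) ==> (t \in S)].

(* The elements of [V] need not all be vertices; in particular the empty
   complex is allowed, as it occurs as a link. *)
Record complex := Complex {
  simplices :> {set {set V}};
  complexP : is_complex simplices
}.

HB.instance Definition _ := [isSub for simplices].
HB.instance Definition _ := [Equality of complex by <:].

Lemma is_complexP (S : {set {set V}}) :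
  reflect (set0 \notin S /\
           forall s t : {set V}, s \in S -> t != set0 -> t \subset s -> t \in S)
          (is_complex S).
Proof.
apply: (iffP andP) => -[S0 Sd]; split=> //.
  move=> s t sS t0 ts.
  by move/forall_inP: Sd => /(_ s sS) /forallP/(_ t); rewrite t0 ts.
apply/forall_inP => s sS; apply/forallP => t; apply/implyP => /andP[t0 ts].
exact: Sd sS t0 ts.
Qed.

Implicit Types (K L : complex) (v : V).

Definition vertices K : {set V} := [set v | [set v] \in simplices K].

Lemma full_subcomplex_subproof K (W : {set V}) :
  is_complex [set s in simplices K | s \subset W].
Proof.
have /is_complexP[K0 Kd] := complexP K.
apply/is_complexP; split=> [|s t]; first by rewrite inE negb_and K0.
rewrite !inE => /andP[sK sW] t0 ts.
by rewrite (Kd s t) //= (subset_trans ts sW).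
Qed.

Definition full_subcomplex K (W : {set V}) : complex :=
  Complex (full_subcomplex_subproof K W).

Definition deletion K v : complex := full_subcomplex K (vertices K :\ v).

Lemma link_subproof K v :
  is_complex [set s in simplices K | (v \notin s) && (v |: s \in simplices K)].
Proof.
have /is_complexP[K0 Kd] := complexP K.
apply/is_complexP; split=> [|s t]; first by rewrite inE negb_and K0.
rewrite !inE => /and3P[sK vs vsK] t0 ts.
rewrite (Kd s t) //= (contra (subsetP ts v)) //=.
apply: Kd vsK _ (setUS _ ts).
by apply/set0Pn; exists v; rewrite setU11.
Qed.

Definition link K v : complex := Complex (link_subproof K v).

Inductive complex_nonevasive : complex -> Prop :=
| ComplexNonevasivePoint K of #|vertices K| = 1 : complex_nonevasive K
| ComplexNonevasiveStep K v of
    v \in vertices K & complex_nonevasive (deletion K v) &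
    complex_nonevasive (link K v) : complex_nonevasive K.

Definition complex_NE_elementary K L : Prop :=
  exists v, [/\ v \in vertices K, complex_nonevasive (link K v)
              & L = deletion K v].

Definition complex_NE_collapse : complex -> complex -> Prop :=
  clos_refl_trans_1n _ complex_NE_elementary.

End Complexes.

Arguments complex V : clear implicits.

Section OrderComplex.

Context {d : Order.disp_t} {T : finPOrderType d}.

Definition is_chain (s : {set T}) : bool :=
  [forall x in s, forall y in s, (x >=< y)%O].

Lemma order_complex_subproof (A : {set T}) :
  is_complex [set s : {set T} | [&& s != set0, s \subset A & is_chain s]].
Proof.
apply/is_complexP; split=> [|s t]; first by rewrite inE eqxx.
rewrite !inE => /and3P[_ sA /forall_inP sC] -> ts /=.
rewrite (subset_trans ts sA) /=.
apply/forall_inP => x /(subsetP ts) xs; apply/forall_inP => y /(subsetP ts).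
exact/forall_inP/sC.
Qed.

Definition order_complex (A : {set T}) : complex T :=
  Complex (order_complex_subproof A).

End OrderComplex.

(* Main.v *)
Require Import Defs.
From Stdlib Require Import Relation_Operators.
From mathcomp Require Import all_boot all_order.

(** Taking order complexes commutes with deleting a point and with taking
    links, so every NE-collapse, and every witness of non-evasiveness, is
    carried over step by step. *)

Import Order.POrderTheory.

Section OrderComplexNE.

Context {d : Order.disp_t} {T : finPOrderType d}.
Implicit Types (A B s : {set T}) (x : T).

(** A nonempty set [s] avoiding [x] is a simplex of the link of [x] in the order complex of [A]
    exactly when [x |: s] is a chain of [A], that is, when [s] is a chain of points comparable with
    [x]: a chain of [space_link A x]. Hence [link_order_complex], and similarly
    [deletion_order_complex]; induction on non-evasiveness then transports each elementary
    collapse. *)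

Lemma is_chainP s :
  reflect {in s &, forall x y, (x >=< y)%O} (is_chain s).
Proof.
apply: (iffP forall_inP) => [sC x y xs ys|sC x xs].
  exact: (forall_inP (sC x xs)).
by apply/forall_inP => y ys; apply: sC.
Qed.

Lemma is_chain_set1 x : is_chain [set x].
Proof.
by apply/is_chainP => y z /set1P-> /set1P->; exact: comparablexx.
Qed.

Lemma is_chainU1 x s :
  is_chain (x |: s) = is_chain s && [forall y in s, (y >=< x)%O].
Proof.
apply/is_chainP/andP => [xsC|[/is_chainP sC /forall_inP sx] y z].
  split; first by apply/is_chainP => y z ys zs; apply: xsC; apply: setU1r.
  by apply/forall_inP => y ys; apply: xsC; [apply: setU1r | apply: setU11].
move=> /setU1P[->|ys] /setU1P[->|zs].
- exact: comparablexx.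
- by rewrite comparable_sym sx.
- exact: sx.
- exact: sC.
Qed.

Lemma vertices_order_complex A : vertices (order_complex A) = A.
Proof.
apply/setP => x; rewrite !inE sub1set is_chain_set1 andbT.
by rewrite -cards_eq0 cards1.
Qed.

Lemma deletion_order_complex A x :
  deletion (order_complex A) x = order_complex (A :\ x).
Proof.
(* Since [is_complex] is boolean, complexes with the same simplices are equal, as
   [complex_NE_elementary] demands. *)
apply/val_inj/setP => s; rewrite /= !inE vertices_order_complex subsetD1.
by case: (s \subset A); rewrite ?andbF //= -!andbA [is_chain s && _]andbC.
Qed.

Lemma subset_space_link A x s :
  (s \subset space_link A x) =
  [&& s \subset A, x \notin s & [forall y in s, (y >=< x)%O]].
Proof.
apply/subsetP/and3P => [sL|[/subsetP sA xs /forall_inP sx] y ys].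
  split.
  - by apply/subsetP => y /sL; rewrite inE => /and3P[].
  - by apply/negP => /sL; rewrite inE eqxx andbF.
  - by apply/forall_inP => y /sL; rewrite inE => /and3P[].
by rewrite inE sA // sx // andbT; apply: contraNneq xs => <-.
Qed.

(** Membership of [x] in [A] makes [x |: s] a subset of [A] whenever [s] is one. *)
Lemma link_order_complex A x :
  x \in A -> link (order_complex A) x = order_complex (space_link A x).
Proof.
move=> xA; apply/val_inj/setP => s.
rewrite /= !inE subset_space_link is_chainU1 subUset sub1set xA /=.
have -> : x |: s != set0 by apply/set0Pn; exists x; rewrite setU11.
by case: (s \subset A); rewrite ?andbF //=; case: (is_chain s); rewrite ?andbF ?andbT.
Qed.

Lemma order_complex_nonevasive A :
  space_nonevasive A -> complex_nonevasive (order_complex A).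
Proof.
elim=> [x|{}A x xA _ IHlink _ IHdel].
  by apply: ComplexNonevasivePoint; rewrite vertices_order_complex cards1.
apply: (@ComplexNonevasiveStep _ _ x).
- by rewrite vertices_order_complex.
- by rewrite deletion_order_complex.
- by rewrite link_order_complex.
Qed.

Lemma order_complex_NE_elementary A B :
  space_NE_elementary A B ->
  complex_NE_elementary (order_complex A) (order_complex B).
Proof.
case=> x [xA Lne ->]; exists x; split.
- by rewrite vertices_order_complex.
- by rewrite link_order_complex //; apply: order_complex_nonevasive.
- by rewrite deletion_order_complex.
Qed.

(** The source [A] is arbitrary because, after one step, a collapse no longer starts from the whole
    space. *)
Lemma order_complex_NE_collapse A B :
  space_NE_collapse A B ->
  complex_NE_collapse (order_complex A) (order_complex B).
Proof.
elim=> [C|C D E CD _]; first exact: rt1n_refl.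
by apply: rt1n_trans; apply: order_complex_NE_elementary.
Qed.

End OrderComplexNE.

Theorem theorem5p7 (d : Order.disp_t) (X : finPOrderType d) (Y : {set X}) :
  space_NE_collapse [set: X] Y ->
  complex_NE_collapse (order_complex [set: X]) (order_complex Y).
Proof. exact: order_complex_NE_collapse. Qed.
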